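(* For an integer $p\ge0$ let $P(p)=\{x\in[0,1]^d:\|x-\tfrac12 e\|_1\le \tfrac p2\}$. Then for every integer $p$ with $0<p<d$, $N_+(P(p))\supseteq P(p-1)$. Furthermore, $P(1)\neq\emptyset$ while $P(d-1)$ contains no integer point (so $\mathrm{conv}(P(d-1)\cap\mathbb{Z}^d)=\emptyset$). Consequently $N_+^{d-1}(P(d-1))\neq\emptyset$, i.e. the $N_+$ procedure requires $d$ iterations to prove that $P(d-1)$ contains no integer point.
   Context: $e\in\mathbb{R}^d$ is the all-ones vector and $\|\cdot\|_1$ the $\ell_1$ norm. Vectors in $\mathbb{R}^{d+1}$ have coordinates indexed $0,\dots,d$ and are written $(x_0,x)$. $Q\subseteq\mathbb{R}^{d+1}$ is the convex cone generated by all $(1,x)$ with $x\in\{0,1\}^d$; for a convex cone $C$, $C^*=\{s:s^Tx\ge0\ \forall x\in C\}$. For a convex cone $K\subseteq Q$, $M_+(K)$ is the set of real symmetric positive semidefinite $(d+1)\times(d+1)$ matrices $Y$ with $Ye_0=\mathrm{diag}(Y)$ and $u^TYv\ge0$ for all $u\in Q^*,v\in K^*$; $N_+(K)=\{\mathrm{diag}(Y):Y\in M_+(K)\}$; $N_+^0(K)=K$, $N_+^r(K)=N_+(N_+^{r-1}(K))$. For a convex set $P\subseteq[0,1]^d$, $K_P=\{(\lambda,\lambda x):x\in P,\lambda\ge0\}$ and $N_+^r(P)=\{x:(1,x)\in N_+^r(K_P)\}$. *)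

(* Defs.v *)
From mathcomp Require Import all_boot all_order all_algebra.
From mathcomp Require Import boolp classical_sets reals convex.

Set Implicit Arguments.
Unset Strict Implicit.
Unset Printing Implicit Defensive.

Import Order.TTheory GRing.Theory Num.Theory.

Local Open Scope classical_set_scope.
Local Open Scope ring_scope.

(* Points of R^d are column vectors 'cV[R]_d; points (x_0, x) of R^(d+1) are
   block columns of type 'cV[R]_(1 + d), so that index 0 is ord0. *)

Section ConvexHulls.
Variables (R : realType) (n : nat).
Implicit Types (C S : set 'cV[R]_n).

Definition convex_hull S : set 'cV[R]_n := smallest (@convex_set R _) S.

Definition convex_cone C : Prop :=
  [/\ C 0,
      forall x y, C x -> C y -> C (x + y)
    & forall (a : R) x, 0 <= a -> C x -> C (a *: x)].

Definition cone_hull S : set 'cV[R]_n := smallest convex_cone S.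

Definition dual_cone C : set 'cV[R]_n :=
  [set s | forall x, C x -> 0 <= (s^T *m x) ord0 ord0].

Definition psd (Y : 'M[R]_n) : Prop :=
  forall x : 'cV[R]_n, 0 <= (x^T *m Y *m x) ord0 ord0.

(* The column vector of diagonal entries (diag_mx is the converse
   operation, on row vectors). *)
Definition diagv (Y : 'M[R]_n) : 'cV[R]_n := \col_i Y i i.

Definition l1norm (x : 'cV[R]_n) : R := \sum_i `|x i ord0|.

Definition integer_points : set 'cV[R]_n :=
  [set x | forall i, x i ord0 \is a Num.int].

End ConvexHulls.

Section LiftAndProject.
Variables (R : realType) (d : nat).
Implicit Types (K : set 'cV[R]_(1 + d)) (P : set 'cV[R]_d).

Definition homog (a : R) (x : 'cV[R]_d) : 'cV[R]_(1 + d) := col_mx a%:M x.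

Definition e0 : 'cV[R]_(1 + d) := delta_mx ord0 ord0.

Definition Qcone : set 'cV[R]_(1 + d) :=
  cone_hull [set homog 1 x | x in
    [set x : 'cV[R]_d | forall i, x i ord0 = 0 \/ x i ord0 = 1]].

Definition Mplus K : set 'M[R]_(1 + d) :=
  [set Y | [/\ Y^T = Y,
               psd Y,
               Y *m e0 = diagv Y
             & forall u v, dual_cone Qcone u -> dual_cone K v ->
                 0 <= (u^T *m Y *m v) ord0 ord0]].

Definition Nplus K : set 'cV[R]_(1 + d) := [set diagv Y | Y in Mplus K].

Definition Nplus_iter (r : nat) K : set 'cV[R]_(1 + d) := iter r Nplus K.

Definition homog_cone P : set 'cV[R]_(1 + d) :=
  [set y | exists (a : R) x, [/\ P x, 0 <= a & y = homog a (a *: x)]].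

(* N_+^r applied to a convex subset of the cube; N_+(P) is the case r = 1. *)
Definition NplusP (r : nat) P : set 'cV[R]_d :=
  [set x | Nplus_iter r (homog_cone P) (homog 1 x)].

Definition Pball (p : nat) : set 'cV[R]_d :=
  [set x : 'cV[R]_d | (forall i, 0 <= x i ord0 <= 1) /\
           l1norm (x - 2^-1 *: const_mx 1) <= p%:R / 2].

(* Iteration r of the procedure proves that P contains no integer point when
   the relaxation N_+^r(P), which contains every integer point of P, is empty;
   the number of iterations required is the least such r. *)
Definition Nplus_iterations_required P (r : nat) : Prop :=
  NplusP r P = set0 /\ forall s, (s < r)%N -> NplusP s P !=set0.

End LiftAndProject.

Arguments Pball : clear implicits.
Arguments integer_points : clear implicits.

(* Main.v *)
Require Import Defs.
From mathcomp Require Import all_boot all_order all_algebra.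
From mathcomp Require Import boolp classical_sets reals convex.
From mathcomp Require Import ring lra zify.

Import Order.TTheory GRing.Theory Num.Theory.

Local Open Scope classical_set_scope.
Local Open Scope ring_scope.

(* Replacing one coordinate of a point of the cube by 0 or 1 increases its l_1
   distance to the centre by at most 1/2.  Hence, for x in P(p-1) and y = (1, x),
   the matrix Y = y y^T + diag(y_i - y_i^2) certifies x in N_+(P(p)): its columns
   Y e_i and Y (e_0 - e_i) are nonnegative multiples of points (1, x') with x' in
   P(p).  Iterating, the centre of the cube survives d-1 rounds from P(d-1).

   Conversely, every point of P(d-1) has l_1 distance at least 1/2 to every 0/1
   point s.  Each round of N_+ allows one coordinate to be dropped from that
   distance, so after d rounds the inequality reads 0 >= 1/2. *)

Set Implicit Arguments.
Unset Strict Implicit.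
Unset Printing Implicit Defensive.

Section Cones.
Context {R : realType} {d : nat}.
Implicit Types (u v w y z : 'cV[R]_(1 + d)) (x : 'cV[R]_d).
Implicit Types (K : set 'cV[R]_(1 + d)) (Y : 'M[R]_(1 + d)).

(** * Inner products and homogenized points *)

Lemma dotE n (u v : 'cV[R]_n) :
  (u^T *m v) ord0 ord0 = \sum_i u i ord0 * v i ord0.
Proof. by rewrite mxE; apply: eq_bigr => i _; rewrite mxE. Qed.

Lemma homog0E a x : homog a x ord0 ord0 = a.
Proof.
have -> : (ord0 : 'I_(1 + d)) = lshift d ord0 by apply: val_inj.
by rewrite /homog col_mxEu mxE eqxx mulr1n.
Qed.

Lemma homogSE a x i : homog a x (lift ord0 i) ord0 = x i ord0.
Proof. by rewrite -rshift1 /homog col_mxEd. Qed.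

Lemma dot_homog u a x : (u^T *m homog a x) ord0 ord0 =
  u ord0 ord0 * a + \sum_(i < d) u (lift ord0 i) ord0 * x i ord0.
Proof.
rewrite dotE big_ord_recl homog0E; congr (_ + _).
by apply: eq_bigr => i _; rewrite homogSE.
Qed.

Lemma homogZ a b x : homog (a * b) (a *: x) = a *: homog b x.
Proof. by rewrite /homog scale_col_mx scale_scalar_mx. Qed.

Lemma homog_cone_homog (P : set 'cV[R]_d) x : P x -> homog_cone P (homog 1 x).
Proof. by move=> Px; exists 1, x; rewrite scale1r. Qed.

(** * The cone Q and its dual *)

Lemma Qcone_vertex x : (forall i, x i ord0 = 0 \/ x i ord0 = 1) ->
  Qcone (homog 1 x).
Proof. by move=> x01 C [_]; apply; exists x. Qed.

Lemma Qcone_bounds z : Qcone z ->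
  forall i, 0 <= z (lift ord0 i) ord0 <= z ord0 ord0.
Proof.
move=> Qz i; apply: (Qz [set z | 0 <= z (lift ord0 i) ord0 <= z ord0 ord0]).
split=> [|z' [x x01 <-]]; last first.
  by rewrite /= homog0E homogSE; case: (x01 i) => ->; rewrite ?lexx ?ler01.
split=> /= [|y z' /andP[y0 y1] /andP[z0 z1]|a z' a0 /andP[z0 z1]].
- by rewrite !mxE lexx.
- by rewrite !mxE addr_ge0// lerD.
- by rewrite !mxE mulr_ge0// ler_wpM2l.
Qed.

(** [face0 i] and [face1 i] are the homogenized facet inequalities [x_i >= 0] and [1 - x_i >= 0] of
    the cube. *)
Definition face0 (i : 'I_d) : 'cV[R]_(1 + d) := delta_mx (lift ord0 i) ord0.
Definition face1 (i : 'I_d) : 'cV[R]_(1 + d) := e0 R d - face0 i.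

Lemma delta_dot n k (M : 'M[R]_(n, k)) i j :
  ((delta_mx i ord0 : 'cV[R]_n)^T *m M) ord0 j = M i j.
Proof. by rewrite trmx_delta -rowE mxE. Qed.

Lemma face1_dot i k (M : 'M[R]_(1 + d, k)) j :
  ((face1 i)^T *m M) ord0 j = M ord0 j - M (lift ord0 i) j.
Proof. by rewrite /face1 linearB mulmxBl mxE [X in _ + X]mxE !delta_dot. Qed.

Lemma face0_dual i : dual_cone (@Qcone R d) (face0 i).
Proof. by move=> z /Qcone_bounds/(_ i)/andP[z0 _]; rewrite delta_dot. Qed.

Lemma face1_dual i : dual_cone (@Qcone R d) (face1 i).
Proof.
move=> z /Qcone_bounds/(_ i)/andP[_ z1].
by rewrite face1_dot subr_ge0.
Qed.

(** The right-hand side is the minimum of [u] over the vertices [(1, x)] of the cube, attained at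
    the indicator of the negative coefficients of [u]. *)
Lemma Qcone_dual_min u : dual_cone (@Qcone R d) u ->
  0 <= u ord0 ord0 + \sum_(i < d) Num.min (u (lift ord0 i) ord0) 0.
Proof.
move=> Qu; pose c : 'cV[R]_d := \col_i (u (lift ord0 i) ord0 < 0)%R%:R.
have /Qu : Qcone (homog 1 c).
  by apply: Qcone_vertex => i; rewrite mxE; case: ltP; [right | left].
rewrite dot_homog mulr1; congr (_ <= _ + _).
by apply: eq_bigr => i _; rewrite mxE; case: ltP; rewrite ?mulr1 ?mulr0.
Qed.

(** * The certificate matrix *)

(** For [y = (1, x)] with [x] in the cube, this is the second-moment matrix of [(1, X)], where the
    [X_i] are independent 0/1 variables of mean [x_i]. *)
Definition moment y : 'M[R]_(1 + d) :=
  y *m y^T + diag_mx (\row_i (y i ord0 - y i ord0 ^+ 2)).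

Lemma momentE y i j :
  moment y i j = y i ord0 * y j ord0 + (y i ord0 - y i ord0 ^+ 2) *+ (i == j).
Proof.
rewrite /moment !mxE big_ord1 !mxE; congr (_ + _).
Qed.

Lemma moment_tr y : (moment y)^T = moment y.
Proof. by rewrite /moment linearD/= trmx_mul trmxK tr_diag_mx. Qed.

Lemma diagv_moment y : diagv (moment y) = y.
Proof.
apply/colP => i; rewrite mxE momentE eqxx mulr1n; ring.
Qed.

Lemma moment_e0 y : y ord0 ord0 = 1 -> moment y *m e0 R d = diagv (moment y).
Proof.
move=> y0; rewrite diagv_moment -colE; apply/colP => i.
rewrite mxE momentE y0 mulr1; case: eqP => [->|_]; rewrite ?mulr0n ?addr0//.
by rewrite y0 expr1n subrr addr0.
Qed.

Lemma moment_form y u v : (u^T *m moment y *m v) ord0 ord0 =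
  (u^T *m y) ord0 ord0 * (v^T *m y) ord0 ord0 +
  \sum_i (y i ord0 - y i ord0 ^+ 2) * (u i ord0 * v i ord0).
Proof.
rewrite /moment mulmxDr mulmxDl mxE; congr (_ + _).
  rewrite mulmxA -mulmxA mxE big_ord1; congr (_ * _).
  by rewrite !dotE; apply: eq_bigr => i _; rewrite mulrC.
rewrite mxE; apply: eq_bigr => i _.
by rewrite mul_mx_diag !mxE; ring.
Qed.

Lemma psd_moment y : (forall i, 0 <= y i ord0 <= 1) -> psd (moment y).
Proof.
move=> y01 x; rewrite moment_form addr_ge0 ?sqr_ge0// -?expr2 ?sqr_ge0//.
apply: sumr_ge0 => i _; have /andP[y0 y1] := y01 i.
by rewrite mulr_ge0 -?expr2 ?sqr_ge0// subr_ge0 expr2 ler_piMr.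
Qed.

Definition fix_coord x (i : 'I_d) (b : R) : 'cV[R]_d :=
  \col_j (if j == i then b else x j ord0).

Lemma dot_fix_coord u x i b :
  (u^T *m homog 1 (fix_coord x i b)) ord0 ord0 =
  (u^T *m homog 1 x) ord0 ord0 + u (lift ord0 i) ord0 * (b - x i ord0).
Proof.
rewrite !dot_homog -addrA; congr (_ + _).
rewrite (bigD1 i)//= [in RHS](bigD1 i)//= mxE eqxx.
rewrite (eq_bigr (fun j => u (lift ord0 j) ord0 * x j ord0)); first by ring.
by move=> j /negbTE ji; rewrite mxE ji.
Qed.

(* Since [Q^*] is generated by [e_i] and [e_0 - e_i], positivity only has to be
   checked on the columns [Y e_i = x_i (1, x[i:=1])] and
   [Y (e_0 - e_i) = (1 - x_i) (1, x[i:=0])]. *)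
Lemma Mplus_moment (P : set 'cV[R]_d) x :
  (forall i, 0 <= x i ord0 <= 1) -> P x ->
  (forall i, P (fix_coord x i 0)) -> (forall i, P (fix_coord x i 1)) ->
  Mplus (homog_cone P) (moment (homog 1 x)).
Proof.
move=> x01 Px P0 P1; split; [exact: moment_tr | | by apply: moment_e0; rewrite homog0E |].
  apply: psd_moment => i; case: (unliftP ord0 i) => [j|] ->.
    by rewrite homogSE.
  by rewrite homog0E ler01 lexx.
move=> u v /Qcone_dual_min u_ge0 Kv.
have {Px} := Kv _ (homog_cone_homog Px).
have {P0} := fun i => Kv _ (homog_cone_homog (P0 i)).
have {P1} := fun i => Kv _ (homog_cone_homog (P1 i)).
move=> H1 H0 H; rewrite moment_form.
rewrite big_ord_recl homog0E expr1n subrr mul0r add0r.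
move: H H0 H1; set phi := (v^T *m _) _ _ => phi_ge0 H0 H1.
rewrite dot_homog mulr1.
(* Splitting off the minimum of [u] over the vertices, which is nonnegative, leaves a sum that can
   be treated one coordinate at a time. *)
have -> : u ord0 ord0 = u ord0 ord0 + \sum_(i < d) Num.min (u (lift ord0 i) ord0) 0
   - \sum_(i < d) Num.min (u (lift ord0 i) ord0) 0 by rewrite addrK.
rewrite -addrA mulrDl -addrA addr_ge0 ?mulr_ge0//.
rewrite -sumrN -big_split/= mulr_suml -big_split/=.
apply: sumr_ge0 => i _; rewrite homogSE.
have := H0 i; have := H1 i; rewrite !dot_fix_coord -/phi => {}H1 {}H0.
have /andP[x0 x1] := x01 i.
(* A negative [u_i] calls for the column of [e_0 - e_i], a nonnegative one for the column of
   [e_i]. *)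
case: (ltP (u (lift ord0 i) ord0) 0) => ui.
  rewrite (_ : _ + _ = (- u (lift ord0 i) ord0) * ((1 - x i ord0) *
     (phi + v (lift ord0 i) ord0 * (0 - x i ord0)))); last by ring.
  by rewrite !mulr_ge0// ?oppr_ge0 ?subr_ge0// ltW.
rewrite (_ : _ + _ = u (lift ord0 i) ord0 * (x i ord0 *
     (phi + v (lift ord0 i) ord0 * (1 - x i ord0)))); last by ring.
by rewrite !mulr_ge0.
Qed.

(** * General properties of the operator [Nplus] *)

Lemma dual_coneS K K' : K `<=` K' -> dual_cone K' `<=` dual_cone K.
Proof. by move=> KK' v K'v x /KK' /K'v. Qed.

Lemma NplusS K K' : K `<=` K' -> Nplus K `<=` Nplus K'.
Proof.
move=> KK' _ [Y [Ysym Ypsd Ye0 Yge0] <-]; exists Y => //; split=> // u v Qu K'v.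
by apply: Yge0 => //; exact: dual_coneS K'v.
Qed.

Lemma Nplus_scale K a y : 0 <= a -> Nplus K y -> Nplus K (a *: y).
Proof.
move=> a0 [Y [Ysym Ypsd Ye0 Yge0] <-].
have diagZ : diagv (a *: Y) = a *: diagv Y by apply/colP => i; rewrite !mxE.
exists (a *: Y) => //; split.
- by rewrite linearZ/= Ysym.
- by move=> x; rewrite -scalemxAr -scalemxAl mxE mulr_ge0.
- by rewrite -scalemxAl Ye0 diagZ.
- by move=> u v Qu Kv; rewrite -scalemxAr -scalemxAl mxE mulr_ge0// Yge0.
Qed.

(** Closure under nonnegative scaling reduces the inclusion to points of height 1. *)
Lemma Nplus_homog_cone K (P : set 'cV[R]_d) :
  (forall x, P x -> Nplus K (homog 1 x)) -> homog_cone P `<=` Nplus K.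
Proof.
move=> PK _ [a [x [Px a0 ->]]]; rewrite -[a in homog a]mulr1 homogZ.
exact/Nplus_scale/PK.
Qed.


(* For [Y] in [M_+(K)] the entry [u^T Y v] vanishes on the pair
   [u = e_i, v = e_0 - e_i], and the two columns [Y e_i] and [Y (e_0 - e_i)] add
   up to [Y e_0 = diag Y]. *)
Lemma Nplus_dual_split K (i : 'I_d) w :
  dual_cone K (w + face0 i) -> dual_cone K (w + face1 i) ->
  dual_cone (Nplus K) w.
Proof.
move=> K0 K1 _ [Y [Ysym _ Ye0 Yge0] <-].
have Y0i j : Y j ord0 = Y j j.
  by have /colP/(_ j) := Ye0; rewrite -colE !mxE.
have Ysw j k : Y j k = Y k j by rewrite -{1}Ysym mxE.
have := Yge0 _ _ (face0_dual i) K1; have := Yge0 _ _ (face1_dual i) K0.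
have formD u v : (u^T *m Y *m (w + v)) ord0 ord0 =
  (u^T *m Y *m w) ord0 ord0 + (u^T *m Y *m v) ord0 ord0.
  by rewrite mulmxDr mxE.
have form0 u j : (u^T *m Y *m (delta_mx j ord0 : 'cV_(1 + d))) ord0 ord0 =
  (u^T *m Y) ord0 j by rewrite -colE mxE.
have form1 u : (u^T *m Y *m face1 i) ord0 ord0 =
  (u^T *m Y) ord0 ord0 - (u^T *m Y) ord0 (lift ord0 i).
  by rewrite /face1 mulmxBr mxE [X in _ + X]mxE !form0.
rewrite !formD form1 form0 face1_dot !delta_dot Ysw Y0i !subrr !addr0.
rewrite -!mulmxA face1_dot delta_dot => H1 H0.
have := addr_ge0 H1 H0; rewrite subrK.
by rewrite !dotE !mxE; congr (_ <= _); apply: eq_bigr => j _; rewrite !mxE Ysw Y0i mulrC.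
Qed.

(** * Upper bound on the number of rounds *)

(** At [(1, x)] with [x] in the cube, this functional is the l_1 distance from [x] to the 0/1 point
    [s], counted over the coordinates from [r] on, minus 1/2. *)
Definition gap_sum (s : 'I_d -> bool) (r : nat) : 'cV[R]_(1 + d) :=
  \sum_(i < d | (r <= i)%N) (if s i then face1 i else face0 i) - 2^-1 *: e0 R d.

(** This brings both premises of [Nplus_dual_split] to the form of the induction hypothesis
    below. *)
Lemma gap_sum_fix s (i : 'I_d) b :
  gap_sum (fun j => if j == i then b else s j) i =
  gap_sum s i.+1 + if b then face1 i else face0 i.
Proof.
rewrite /gap_sum (bigD1 i)//= eqxx [RHS]addrC -addrA; congr (_ + (_ - _)).
apply: eq_big => [j|j /andP[_ /negbTE->]//].
by rewrite ltn_neqAle andbC eq_sym.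
Qed.

Lemma Nplus_iter_gap_sum K r : (r <= d)%N ->
  (forall s, dual_cone K (gap_sum s 0)) ->
  forall s, dual_cone (Nplus_iter r K) (gap_sum s r).
Proof.
(* This round drops coordinate [r]; both of its values are needed, so [s] stays universally
   quantified in the induction. *)
move=> + K0; elim: r => [//|r IHr] rd s; apply: (@Nplus_dual_split _ (Ordinal rd)).
  rewrite -(gap_sum_fix s (Ordinal rd) false); exact/IHr/ltnW.
rewrite -(gap_sum_fix s (Ordinal rd) true); exact/IHr/ltnW.
Qed.

Lemma gap_sum_dot s r z : ((gap_sum s r)^T *m z) ord0 ord0 =
  \sum_(i < d | (r <= i)%N) (if s i then z ord0 ord0 - z (lift ord0 i) ord0
                             else z (lift ord0 i) ord0) - 2^-1 * z ord0 ord0.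
Proof.
rewrite /gap_sum linearB mulmxBl mxE [X in _ + X]mxE.
rewrite linearZ/= -scalemxAl [X in _ - X]mxE delta_dot; congr (_ - _).
rewrite linear_sum mulmx_suml summxE; apply: eq_bigr => i _.
by case: (s i); rewrite ?face1_dot ?delta_dot.
Qed.

Lemma l1norm_center x :
  l1norm (x - 2^-1 *: const_mx 1) = \sum_i `|x i ord0 - 2^-1|.
Proof. by apply: eq_bigr => i _; rewrite !mxE mulr1. Qed.

(** Each coordinate is at distance at least [1/2 - |x_i - 1/2|] from 0 and from 1; summing gives at
    least [d/2 - (d-1)/2 = 1/2]. *)
Lemma Pball_gap_sum s : (0 < d)%N ->
  dual_cone (homog_cone (Pball R d d.-1)) (gap_sum s 0).
Proof.
move=> d_gt0 _ [a [x [[x01 xd] a0 ->]]]; move: xd; rewrite l1norm_center => xd.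
rewrite gap_sum_dot homog0E.
rewrite (eq_bigr (fun i => a * (if s i then 1 - x i ord0 else x i ord0))); last first.
  by move=> i _; rewrite homogSE mxE; case: (s i) => //; ring.
rewrite -mulr_sumr [2^-1 * a]mulrC -mulrBr mulr_ge0// subr_ge0.
have : \sum_(i < d) (2^-1 : R) - \sum_i `|x i ord0 - 2^-1| <=
       \sum_(i < d) (if s i then 1 - x i ord0 else x i ord0).
  rewrite -sumrB ler_sum// => i _.
  by case: (s i); case: (ger0P (x i ord0 - 2^-1)) => ?; lra.
rewrite sumr_const card_ord -[d in 2^-1 *+ d](prednK d_gt0) mulrS -[_ *+ d.-1]mulr_natl.
by move=> H; apply: le_trans H; lra.
Qed.

Lemma Nplus_iter_Pball_height0 y : (0 < d)%N ->
  Nplus_iter d (homog_cone (Pball R d d.-1)) y -> y ord0 ord0 <= 0.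
Proof.
move=> d_gt0 /(Nplus_iter_gap_sum (leqnn d) (fun s => Pball_gap_sum s d_gt0)).
(* At [r = d] no coordinate is left, so any vertex serves and the inequality reads
   [0 <= - y_0 / 2]. *)
move=> /(_ (fun=> true)); rewrite gap_sum_dot big_pred0; first by lra.
by move=> i; rewrite leqNgt ltn_ord.
Qed.

(** * Balls around the centre and their survival *)

Lemma Pball_fix_coord p x i (b : R) : 0 <= b <= 1 ->
  Pball R d p x -> Pball R d p.+1 (fix_coord x i b).
Proof.
move=> b01 [x01]; rewrite /Pball/= !l1norm_center => xp; split=> [j|].
  by rewrite mxE; case: eqP.
rewrite (bigD1 i)//= mxE eqxx.
rewrite (eq_bigr (fun j => `|x j ord0 - 2^-1|)); last first.
  by move=> j /negbTE ji; rewrite mxE ji.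
move: xp; rewrite (bigD1 i)//= -[p.+1%:R]natr1.
have := normr_ge0 (x i ord0 - 2^-1).
have : `|b - 2^-1| <= 2^-1 by case/andP: b01 => ? ?; rewrite ler_norml; lra.
by lra.
Qed.

Lemma PballS p : Pball R d p `<=` Pball R d p.+1.
Proof.
move=> x [x01 xp]; split=> //; apply: le_trans xp _.
by rewrite ler_pM2r ?invr_gt0 ?ltr0n// ler_nat.
Qed.

Lemma Pball_sub_Nplus p x : Pball R d p x ->
  Nplus (homog_cone (Pball R d p.+1)) (homog 1 x).
Proof.
move=> Px; exists (moment (homog 1 x)); last exact: diagv_moment.
apply: Mplus_moment; [exact: Px.1 | exact: PballS | |];
by move=> i; apply: Pball_fix_coord; rewrite ?lexx ?ler01.
Qed.

(** Induction on [r] for all [p]: one round leads from [p] to [p + 1], and monotonicity applies that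
    round to the hypothesis at [p + 1]. *)
Lemma Nplus_iter_Pball p r :
  homog_cone (Pball R d p) `<=` Nplus_iter r (homog_cone (Pball R d (p + r))).
Proof.
elim: r p => [|r IHr] p; first by rewrite addn0.
rewrite addnS -addSn => y py.
apply: NplusS (IHr p.+1) _ _.
exact: (Nplus_homog_cone (@Pball_sub_Nplus p)).
Qed.

Lemma Pball_center p : Pball R d p (2^-1 *: const_mx 1).
Proof.
split=> [i|]; first by rewrite !mxE mulr1; apply/andP; split; lra.
rewrite subrr /l1norm big1 ?divr_ge0// => i _.
by rewrite mxE normr0.
Qed.

Lemma NplusP_Pball_neq0 p r : (r <= p)%N -> NplusP r (Pball R d p) !=set0.
Proof.
move=> rp; exists (2^-1 *: const_mx 1); rewrite -(subnK rp).
exact/Nplus_iter_Pball/homog_cone_homog/Pball_center.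
Qed.

(** An integer point of the cube has every coordinate at distance exactly 1/2 from the centre, in
    total [d/2 > (d-1)/2]. *)
Lemma Pball_integer_points :
  (0 < d)%N -> Pball R d d.-1 `&` integer_points R d = set0.
Proof.
move=> d_gt0; rewrite -subset0 => x [[x01]]; rewrite l1norm_center => xd xint.
have half i : `|x i ord0 - 2^-1| = 2^-1.
  have /andP[x0 x1] := x01 i; have /intrP[m xm] := xint i.
  move: x0 x1; rewrite xm ler0z lerz1 => m0 m1.
  have [->|->] : m = 0 \/ m = 1 by lia.
    by rewrite sub0r normrN ger0_norm// invr_ge0.
  by rewrite ger0_norm; lra.
move: xd; rewrite (eq_bigr _ (fun i _ => half i)) sumr_const card_ord.
rewrite -[d in 2^-1 *+ d](prednK d_gt0) mulrS -[_ *+ d.-1]mulr_natl.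
by move=> H; lra.
Qed.

End Cones.

Lemma convex_hull0 (R : realType) n : convex_hull (set0 : set 'cV[R]_n) = set0.
Proof. by rewrite -subset0; apply: smallest_sub. Qed.

Theorem theorem4p3 (R : realType) (d : nat) (d_gt0 : (0 < d)%N) :
  [/\ forall p : nat, (0 < p < d)%N ->
        Pball R d p.-1 `<=` NplusP 1 (Pball R d p),
      Pball R d 1 !=set0,
      Pball R d d.-1 `&` integer_points R d = set0 /\
      convex_hull (Pball R d d.-1 `&` integer_points R d) = set0
    & NplusP d.-1 (Pball R d d.-1) !=set0 /\
      Nplus_iterations_required (Pball R d d.-1) d].
Proof.
split.
- by move=> [//|p] _ x Px; apply: Pball_sub_Nplus.
- by exists (2^-1 *: const_mx 1); apply: Pball_center.
- by rewrite Pball_integer_points// convex_hull0.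
split; first exact: NplusP_Pball_neq0.
split=> [|s sd]; last by apply: NplusP_Pball_neq0; rewrite -ltnS prednK.
(* A point surviving [d] rounds would have height 1, yet height at most 0. *)
rewrite -subset0 => x /(Nplus_iter_Pball_height0 d_gt0).
by rewrite homog0E ler10.
Qed.
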